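(* Let $(\mathcal M,\xi,\psi,\gamma)$ be an ambient Leibnizian structure on a manifold of dimension $d+2$ and let $x\in\mathcal M$. The set of automorphisms of $T_x\mathcal M$ preserving the collection of Leibnizian bases at $x$ forms a group isomorphic to the inhomogeneous Carroll group $\mathrm{Carr}(d+1)\subset GL(d+2,\mathbb R)$ defined by the following set of matrices: $$T=\begin{pmatrix}1&a&-\mathbf f^T\mathbf R\\0&1&0\\0&\mathbf b&\mathbf R\end{pmatrix},\qquad a\in\mathbb R,\ \mathbf b,\mathbf f\in\mathbb R^d,\ \mathbf R\in O(d).$$
   Context: An ambient Leibnizian structure $(\mathcal M,\xi,\psi,\gamma)$ consists of a manifold $\mathcal M$ with a complete nowhere-vanishing vector field $\xi$ (generating a free proper $\mathbb R$-action), a nowhere-vanishing 1-form $\psi$ with $\psi(\xi)=0$, and a field $\gamma$ of positive semi-definite symmetric bilinear forms on $\ker\psi$ whose radical is spanned by $\xi$. A Leibnizian basis of $T_x\mathcal M$ is an ordered basis $\{\xi,N,e_1,\dots,e_d\}$, with first vector $\xi_x$, such that $\psi(N)=1$, $\psi(e_i)=0$ and $\gamma(e_i,e_j)=\delta_{ij}$. Preserving the collection means mapping every Leibnizian basis at $x$ to a Leibnizian basis at $x$. *)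

(* Defs.v *)
From HB Require Import structures.
From mathcomp Require Import all_boot all_order all_algebra.
From mathcomp Require Import all_classical all_reals all_analysis.

Set Implicit Arguments.
Unset Strict Implicit.
Unset Printing Implicit Defensive.

Import Order.TTheory GRing.Theory Num.Theory numFieldNormedType.Exports.

Local Open Scope classical_set_scope.
Local Open Scope ring_scope.

Section Smooth.
Variables (R : realType) (V W : normedModType R).

(* Meant for [U] open: the values of [f] outside [U] are then irrelevant. *)
Fixpoint Ck (k : nat) (U : set V) (f : V -> W) : Prop :=
  match k with
  | 0%N => forall y, U y -> {for y, continuous f}
  | k'.+1 => (forall y, U y -> differentiable f y) /\
             (forall v, Ck k' U (fun y => 'D_v f y))
  end.

Definition smooth_on (U : set V) (f : V -> W) : Prop := forall k, Ck k U f.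

End Smooth.

(* A chart and its inverse are total functions; they are meaningful only on
   [chart_dom] and on its image. *)
Record chart (R : realType) (n : nat) (T : topologicalType) := Chart {
  chart_dom : set T;
  chart_fun :> T -> 'rV[R]_n;
  chart_inv : 'rV[R]_n -> T;
  chart_dom_open : open chart_dom;
  chart_img_open : open (chart_fun @` chart_dom);
  chart_funK : forall x, chart_dom x -> chart_inv (chart_fun x) = x;
  chart_continuous : forall x, chart_dom x -> {for x, continuous chart_fun};
  chart_inv_continuous :
    forall x, chart_dom x -> {for chart_fun x, continuous chart_inv} }.

Definition transition (R : realType) (n : nat) (T : topologicalType)
    (c c' : chart R n T) : 'rV[R]_n -> 'rV[R]_n := c' \o chart_inv c.

Record manifold (R : realType) (n : nat) := Manifold {
  carrier :> topologicalType;
  atlas : set (chart R n carrier);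
  manifold_hausdorff : hausdorff_space carrier;
  manifold_second_countable : @second_countable carrier;
  atlas_cover : forall x, exists2 c, atlas c & chart_dom c x;
  atlas_smooth : forall c c', atlas c -> atlas c' ->
    smooth_on (c @` (chart_dom c `&` chart_dom c')) (transition c c') }.

Definition chart_at (R : realType) (n : nat) (M : manifold R n) (x : M)
    (c : chart R n M) : Prop := atlas c /\ chart_dom c x.

Section Tangent.
Variables (R : realType) (n : nat) (M : manifold R n) (x : M).
Implicit Types (c : chart R n M).

(* A tangent vector at [x] is given by its components in every chart of the
   atlas around [x], which transform by the differential of the changes of
   charts; the components in the other charts are set to 0. *)
Definition is_tangent : {pred chart R n M -> 'rV[R]_n} := fun v =>
  `[< (forall c c', chart_at x c -> chart_at x c' ->
         v c' = 'D_(v c) (transition c c') (c x)) /\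
      (forall c, ~ chart_at x c -> v c = 0) >].

Record tangent := Tangent {
  components :> chart R n M -> 'rV[R]_n;
  _ : components \in is_tangent }.

Lemma differentiable_transition c c' : chart_at x c -> chart_at x c' ->
  differentiable (transition c c') (c x).
Proof.
move=> [ac dc] [ac' dc']; have [+ _] := atlas_smooth ac ac' 1%N.
by apply; exists x.
Qed.

Lemma near_chart c c' : chart_at x c -> chart_at x c' ->
  \forall y \near c x,
    exists2 z, c z = y & chart_dom c z /\ chart_dom c' z.
Proof.
move=> [ac dc] [ac' dc'].
have h1 : nbhs (c x) (c @` chart_dom c).
  by apply: open_nbhs_nbhs; split; [exact: chart_img_open|exists x].
have h2 : nbhs (c x) (chart_inv c @^-1` chart_dom c').
  apply: (chart_inv_continuous dc); rewrite chart_funK //.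
  by apply: open_nbhs_nbhs; split => //; exact: chart_dom_open.
apply: filterS2 h1 h2 => y [z dz <-]; rewrite /= chart_funK // => dz'.
by exists z.
Qed.

Lemma derive_transition_linear c c' : chart_at x c -> chart_at x c' ->
  linear (fun v => 'D_v (transition c c') (c x)).
Proof.
move=> xc xc' a u v; have d := differentiable_transition xc xc'.
by rewrite /= !deriveE // linearP.
Qed.

Lemma derive_transition_id c v : chart_at x c ->
  'D_v (transition c c) (c x) = v.
Proof.
move=> xc; rewrite -[RHS](derive_id (c x) v); apply: near_eq_derive.
have := near_chart xc xc; apply: filterS => y [z <- [dz _]].
by rewrite /transition /= chart_funK.
Qed.

Lemma derive_transition_comp c c' c'' v :
  chart_at x c -> chart_at x c' -> chart_at x c'' ->
  'D_v (transition c c'') (c x) =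
  'D_('D_v (transition c c') (c x)) (transition c' c'') (c' x).
Proof.
move=> xc xc' xc''.
have d := differentiable_transition xc xc'.
have e : transition c c' (c x) = c' x.
  by rewrite /transition /= chart_funK //; case: xc.
have d' : differentiable (transition c' c'') (transition c c' (c x)).
  by rewrite e; exact: differentiable_transition.
transitivity ('D_v (transition c' c'' \o transition c c') (c x)).
  apply: near_eq_derive; have := near_chart xc xc'.
  apply: filterS => y [z <- [dz dz']].
  by rewrite /transition /= chart_funK // chart_funK.
rewrite deriveE; last exact: differentiable_comp.
by rewrite diff_comp //= e -deriveE -?e // -deriveE.
Qed.

Lemma is_tangent_submod : submod_closed is_tangent.
Proof.
split.
  apply/asboolP; split=> // c c' xc xc'.
  by rewrite deriveE ?linear0//; exact: differentiable_transition.
move=> a u v /asboolP[u1 u0] /asboolP[v1 v0]; apply/asboolP; split.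
  move=> c c' xc xc'; rewrite /GRing.add /GRing.scale /=.
  by rewrite (u1 c c') // (v1 c c') // (derive_transition_linear xc xc').
by move=> c nc; rewrite /GRing.add /GRing.scale /= u0 // v0 // scaler0 addr0.
Qed.

HB.instance Definition _ :=
  GRing.isSubmodClosed.Build R (chart R n M -> 'rV[R]_n) is_tangent
    is_tangent_submod.
HB.instance Definition _ := [isSub of tangent for components].
HB.instance Definition _ := [Choice of tangent by <:].
HB.instance Definition _ := [SubChoice_isSubLmodule of tangent by <:].

Lemma tangent_vector_axiom : Vector.axiom n tangent.
Proof.
have [c ac dc] := cid2 (atlas_cover x); have xc : chart_at x c by [].
exists (fun v : tangent => v c); first by [].
pose r (w : 'rV[R]_n) : chart R n M -> 'rV[R]_n := fun c' =>
  if `[< chart_at x c' >] then 'D_w (transition c c') (c x) else 0.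
have rP w : r w \in is_tangent.
  apply/asboolP; split=> [c1 c2 x1 x2|c1 x1]; rewrite /r.
    by rewrite !asboolT //; exact: derive_transition_comp.
  by rewrite asboolF.
exists (fun w => Tangent (rP w)) => [v|w] /=.
  apply/val_inj/funext => c' /=; rewrite /r.
  have /asboolP[v1 v0] := valP v.
  by case: asboolP => [xc'|/v0 //]; rewrite -v1.
by rewrite /r asboolT // derive_transition_id.
Qed.

HB.instance Definition _ :=
  Lmodule_hasFinDim.Build R tangent tangent_vector_axiom.

End Tangent.

Section Fields.
Variables (R : realType) (n : nat) (M : manifold R n).

Definition smooth_function (f : M -> R) : Prop :=
  forall c, atlas c -> smooth_on (c @` chart_dom c) (f \o chart_inv c).

Definition smooth_field (X : forall x : M, tangent x) : Prop :=
  forall c, atlas c ->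
    smooth_on (c @` chart_dom c) (fun y => X (chart_inv c y) c).

Definition one_form : Type := forall x : M, 'Hom(tangent x, R^o).

Definition smooth_form (psi : one_form) : Prop :=
  forall X, smooth_field X -> smooth_function (fun x => psi x (X x)).

Definition integral_curve (X : forall x : M, tangent x) (u : R -> M) : Prop :=
  continuous u /\
  forall t c, chart_at (u t) c -> is_derive t 1 (c \o u) (X (u t) c).

(* [X] is complete, and its flow [Phi] is a free and proper action of the
   additive group [R]; smoothness of [Phi] is automatic for a smooth [X]. *)
Definition generates_free_proper_action (X : forall x : M, tangent x) : Prop :=
  exists Phi : R -> M -> M,
    [/\ [/\ continuous (fun p : R * M => Phi p.1 p.2),
            forall x, Phi 0 x = x &
            forall s t x, Phi (s + t) x = Phi s (Phi t x)],
        forall x, integral_curve X (Phi ^~ x),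
        forall t x, Phi t x = x -> t = 0 &
        forall K : set (M * M), compact K ->
          compact [set p : R * M | K (p.2, Phi p.1 p.2)]].

End Fields.

Record ambient_leibnizian (R : realType) (n : nat) (M : manifold R n) :=
    AmbientLeibnizian {
  xi : forall x : M, tangent x;
  psi : one_form M;
  gamma : forall x : M,
    subvs_of (lker (psi x)) -> subvs_of (lker (psi x)) -> R;
  xi_smooth : smooth_field xi;
  xi_neq0 : forall x, xi x != 0;
  xi_action : generates_free_proper_action xi;
  psi_smooth : smooth_form psi;
  psi_neq0 : forall x, psi x != 0;
  psi_xi : forall x, psi x (xi x) = 0;
  gamma_smooth : forall X Y : forall x, subvs_of (lker (psi x)),
    smooth_field (fun x => vsval (X x)) ->
    smooth_field (fun x => vsval (Y x)) ->
    smooth_function (fun x => gamma (X x) (Y x));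
  gamma_linear : forall x w a u v,
    @gamma x (a *: u + v) w = a * gamma u w + gamma v w;
  gamma_sym : forall x u v, @gamma x u v = gamma v u;
  gamma_ge0 : forall x u, 0 <= @gamma x u u;
  gamma_radical : forall x u,
    (forall v, @gamma x u v = 0) <-> vsval u \in <[xi x]>%VS }.

Section LeibnizianBases.
Variables (R : realType) (d : nat) (M : manifold R d.+2).
Variables (L : ambient_leibnizian M) (x : M).

(* [psi (e_i) = 0] is carried by the type of [e]. *)
Definition leibnizian_basis (b : d.+2.-tuple (tangent x)) : Prop :=
  exists (N : tangent x) (e : d.-tuple (subvs_of (lker (psi L x)))),
    [/\ b = [tuple of [:: xi L x, N & map_tuple vsval e]],
        basis_of fullv b,
        psi L x N = 1 &
        forall i j, gamma (tnth e i) (tnth e j) = (i == j)%:R].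

Definition leibnizian_automorphisms : set 'End(tangent x) :=
  [set f | bijective f /\
           forall b, leibnizian_basis b -> leibnizian_basis (map_tuple f b)].

End LeibnizianBases.

Arguments leibnizian_basis [R d M] L x b.
Arguments leibnizian_automorphisms [R d M] L x _.

(* The block decomposition is along [d.+2 = 1 + (1 + d)]. *)
Definition carroll_mx (R : realType) (d : nat)
    (a : R) (b f : 'cV[R]_d) (A : 'M[R]_d) : 'M[R]_d.+2 :=
  block_mx (1%:M : 'M[R]_1) (row_mx (a%:M : 'M[R]_1) (- (f^T *m A)))
           (0 : 'M[R]_(1 + d, 1)) (block_mx (1%:M : 'M[R]_1) 0 b A).

Definition inhomogeneous_carroll (R : realType) (d : nat) :
    set 'M[R]_d.+2 :=
  [set T | exists a b f A, A^T *m A = 1%:M /\ T = carroll_mx a b f A].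

Arguments inhomogeneous_carroll R d _ : clear implicits.

Definition is_group (G : Type) (mul : G -> G -> G) (one : G) (A : set G) :
    Prop :=
  [/\ A one,
      forall g h, A g -> A h -> A (mul g h),
      forall g h k, A g -> A h -> A k -> mul g (mul h k) = mul (mul g h) k,
      forall g, A g -> mul one g = g /\ mul g one = g &
      forall g, A g -> exists h, [/\ A h, mul g h = one & mul h g = one]].

Definition isomorphic_groups (G H : Type) (mulG : G -> G -> G) (A : set G)
    (mulH : H -> H -> H) (B : set H) : Prop :=
  exists F : G -> H, set_bij A B F /\
    forall g h, A g -> A h -> F (mulG g h) = mulH (F g) (F h).

(* Main.v *)
(* Fix one Leibnizian basis (xi, N, e), obtained by Gram-Schmidt modulo the
   radical. In such a basis psi is a coordinate and gamma (u, w) is the sum of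
   the products of the e-coordinates of u and w. Hence an automorphism preserves
   Leibnizian bases iff it fixes xi, psi and gamma, iff its matrix in the fixed
   basis has first column (1, 0, 0), second row (0, 1, 0) and an orthogonal
   lower right block; the remaining entries are free, and they can be written
   as a, b and - f^T R because R is invertible. *)
Require Import Defs.
From HB Require Import structures.
From mathcomp Require Import all_boot all_order all_algebra.
From mathcomp Require Import all_classical all_reals all_analysis.

Set Implicit Arguments.
Unset Strict Implicit.
Unset Printing Implicit Defensive.

Import Order.TTheory GRing.Theory Num.Theory.

Local Open Scope classical_set_scope.
Local Open Scope ring_scope.

(** * Matrices of endomorphisms in a fixed basis *)

Section LinearMatrix.
Variables (K : fieldType) (V : vectType K) (n : nat) (b : n.-tuple V).
Hypothesis b_basis : basis_of fullv b.
Implicit Types f g : 'End(V).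

(* Columns are the images of the basis vectors, so that composition becomes the
   product in the same order; [mxof] uses the transposed convention. *)
Definition lmx f : 'M[K]_n := \matrix_(i, j) coord b i (f b`_j).

Lemma coord_lmx f v i : coord b i (f v) = \sum_j lmx f i j * coord b j v.
Proof.
rewrite {1}(coord_basis b_basis (memvf v)) !linear_sum /=.
by apply: eq_bigr => j _; rewrite mxE mulrC -scalarZ -linearZ.
Qed.

Lemma coord_inj v w : (forall i, coord b i v = coord b i w) -> v = w.
Proof.
move=> h; rewrite (coord_basis b_basis (memvf v)).
by rewrite (coord_basis b_basis (memvf w)); apply: eq_bigr => i _; rewrite h.
Qed.

Lemma lmx_comp f g : lmx (f \o g)%VF = lmx f *m lmx g.
Proof.
apply/matrixP => i j; rewrite !mxE comp_lfunE coord_lmx.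
by apply: eq_bigr => k _; rewrite [lmx g _ _]mxE.
Qed.

Lemma lmx_id : lmx \1%VF = 1%:M.
Proof.
apply/matrixP => i j; rewrite !mxE id_lfunE.
by rewrite coord_free ?(basis_free b_basis) // eq_sym.
Qed.

Lemma lmx_inj : injective lmx.
Proof.
move=> f g fg; apply/lfunP => v; apply: coord_inj => i.
by rewrite !coord_lmx fg.
Qed.

Lemma lmx_surj T : exists f, lmx f = T.
Proof.
pose h v : V := \sum_i (\sum_j T i j * coord b j v) *: b`_i.
have h_lin : linear h.
  move=> a u v; rewrite /h scaler_sumr -big_split; apply: eq_bigr => i _ /=.
  rewrite scalerA -scalerDl mulr_sumr -big_split; congr (_ *: _).
  by apply: eq_bigr => j _ /=; rewrite linearP /= mulrDr mulrCA.
pose hl := GRing.isLinear.Build K V V *:%R h h_lin.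
pose H : {linear V -> V} := HB.pack h hl.
exists (linfun H); apply/matrixP => i j; rewrite mxE lfunE /= /h.
rewrite coord_sum_free ?(basis_free b_basis) // (bigD1 j) //= big1 => [|k kj].
  by rewrite addr0 coord_free ?(basis_free b_basis) // eqxx mulr1.
by rewrite coord_free ?(basis_free b_basis) // eq_sym (negPf kj) mulr0.
Qed.

End LinearMatrix.

(** * The Carroll matrices form a group *)

Section CarrollGroup.
Variables (R : realType) (d : nat).
Implicit Types (a : R) (b f : 'cV[R]_d) (A : 'M[R]_d) (T : 'M[R]_d.+2).

(** Orthogonality of the left factor serves to bring the upper right block back to the required
    shape, through [f'^T *m A' = (A *m f')^T *m (A *m A')]. *)
Lemma carroll_mxM a b f A a' b' f' A' : A^T *m A = 1%:M ->
  carroll_mx a b f A *m carroll_mx a' b' f' A' =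
  carroll_mx (a + a' - (f^T *m A *m b') 0 0) (b + A *m b') (f + A *m f')
             (A *m A').
Proof.
move=> orthA; rewrite /carroll_mx.
rewrite (@mulmx_block _ 1 (1 + d) 1 (1 + d) 1 (1 + d)).
rewrite !mulmx0 !mul0mx !mul1mx !addr0 !add0r.
rewrite (@mulmx_block _ 1 d 1 d 1 d) !mulmx0 !mul0mx !mul1mx !mulmx1 !addr0.
rewrite (@mul_row_block _ 1 1 d 1 d) mulmx1 mulmx0 add0r.
rewrite (@add_row_mx _ 1 1 d) mulNmx.
have -> : a'%:M + (a%:M - f^T *m A *m b') =
          (a + a' - (f^T *m A *m b') 0 0)%:M :> 'M[R]_1.
  by apply/matrixP => i j; rewrite !ord1 !mxE /= !mulr1n addrCA addrA.
have -> : - (f'^T *m A') + - (f^T *m A) *m A' =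
          - ((f + A *m f')^T *m (A *m A')).
  rewrite linearD /= mulmxDl trmx_mul -!mulmxA (mulmxA A^T) orthA mul1mx.
  by rewrite opprD addrC mulNmx !mulmxA.
by rewrite !add0r.
Qed.

Lemma carroll_mx1 : carroll_mx 0 0 0 1%:M = 1%:M :> 'M[R]_d.+2.
Proof.
rewrite /carroll_mx trmx0 mul0mx oppr0 raddf0 (@row_mx0 _ 1 1 d).
by rewrite [RHS](@scalar_mx_block _ 1 (1 + d)) [in RHS](@scalar_mx_block _ 1 d).
Qed.

Lemma carroll_mx_inv T : inhomogeneous_carroll R d T ->
  exists S, [/\ inhomogeneous_carroll R d S, T *m S = 1%:M & S *m T = 1%:M].
Proof.
move=> [a [b [f [A [orthA ->]]]]]; have orthA' := mulmx1C orthA.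
set T' := carroll_mx _ _ _ _.
(* These parameters solve the equations that [carroll_mxM] gives for a product equal to 1:
   [b + A *m b' = 0], [f + A *m f' = 0] and [A *m A' = 1] first, then the scalar entry for [a']. *)
pose S := carroll_mx (- a - (f^T *m b) 0 0) (- (A^T *m b)) (- (A^T *m f)) A^T.
have TS : T' *m S = 1%:M.
  rewrite carroll_mxM // !mulmxN !mulmxA orthA' -(mulmxA f^T) orthA'.
  rewrite mulmx1 !mul1mx !subrr -[RHS]carroll_mx1; congr carroll_mx.
  by rewrite [(- (f^T *m b)) 0 0]mxE opprK addrA subrr add0r addNr.
exists S; split=> //; last exact: mulmx1C.
by exists (- a - (f^T *m b) 0 0), (- (A^T *m b)), (- (A^T *m f)), A^T;
  rewrite trmxK.
Qed.

Lemma inhomogeneous_carroll_group :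
  is_group (fun S T => S *m T) 1%:M (inhomogeneous_carroll R d).
Proof.
split.
- exists 0, 0, 0, 1%:M; split; last by rewrite carroll_mx1.
  by rewrite trmx1 mulmx1.
- move=> _ _ [a [b [f [A [oA ->]]]]] [a' [b' [f' [A' [oA' ->]]]]].
  rewrite carroll_mxM //.
  exists (a + a' - (f^T *m A *m b') 0 0), (b + A *m b'), (f + A *m f'),
    (A *m A'); split=> //.
  by rewrite trmx_mul -mulmxA (mulmxA A^T) oA mul1mx.
- by move=> S T U _ _ _; rewrite mulmxA.
- by move=> T _; rewrite mul1mx mulmx1.
- by move=> T /carroll_mx_inv.
Qed.

Lemma inhomogeneous_carroll_unitmx :
  inhomogeneous_carroll R d `<=` [set T | T \in unitmx].
Proof. by move=> T /carroll_mx_inv[S [_ /mulmx1_unit[]]]. Qed.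

(** * Carroll matrices by entries: index [ord0] stands for xi, [i1] for N and [sh k] for the k-th
    vector of e *)

Local Notation i1 := (lift ord0 ord0 : 'I_d.+2).
Local Notation sh i := (lift ord0 (lift ord0 i : 'I_d.+1) : 'I_d.+2).

Lemma ord_frameP (i : 'I_d.+2) : [\/ i = ord0, i = i1 | exists k, i = sh k].
Proof.
case: (unliftP ord0 i) => [j ->|->]; last by constructor 1.
by case: (unliftP ord0 j) => [k ->|->]; [constructor 3; exists k|constructor 2].
Qed.

(** Block entries are indexed by [lshift] and [rshift], whereas splitting sums over a frame produces
    [lift]; these equations translate. *)
Let e0 : ord0 = lshift (1 + d) (ord0 : 'I_1). Proof. exact: val_inj. Qed.
Let e1 : i1 = rshift 1 (lshift d (ord0 : 'I_1)). Proof. exact: val_inj. Qed.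
Let es i : sh i = rshift 1 (rshift 1 i). Proof. exact: val_inj. Qed.
Let blockE :=
  (@block_mxEul R 1 (1 + d) 1 (1 + d), @block_mxEur R 1 (1 + d) 1 (1 + d),
   @block_mxEdl R 1 (1 + d) 1 (1 + d), @block_mxEdr R 1 (1 + d) 1 (1 + d),
   (@block_mxEul R 1 d 1 d, @block_mxEur R 1 d 1 d),
   (@block_mxEdl R 1 d 1 d, @block_mxEdr R 1 d 1 d),
   (@row_mxEl R 1 1 d, @row_mxEr R 1 1 d)).

Section Entries.
Variables (a : R) (b f : 'cV[R]_d) (A : 'M[R]_d).
Local Notation C := (carroll_mx a b f A).

Lemma carroll_mx_col0 i : C i ord0 = (i == ord0)%:R.
Proof.
case: (ord_frameP i) => [->|->|[k ->]]; rewrite ?[in LHS]e1 ?[in LHS]es.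
all: by rewrite [X in C _ X]e0 ?[X in C X _]e0 blockE mxE.
Qed.

Lemma carroll_mx_row1 j : C i1 j = (j == i1)%:R.
Proof.
rewrite [X in C X _]e1; case: (ord_frameP j) => [->|->|[k ->]].
- by rewrite [X in C _ X]e0 !blockE mxE.
- by rewrite [X in C _ X]e1 !blockE mxE.
- by rewrite [X in C _ X]es !blockE mxE.
Qed.

Lemma carroll_mx_01 : C ord0 i1 = a.
Proof. by rewrite [X in C _ X]e1 [X in C X _]e0 !blockE mxE. Qed.

Lemma carroll_mx_0e j : C ord0 (sh j) = - (f^T *m A) 0 j.
Proof. by rewrite [X in C _ X]es [X in C X _]e0 !blockE mxE. Qed.

Lemma carroll_mx_e1 i : C (sh i) i1 = b i 0.
Proof. by rewrite [X in C _ X]e1 [X in C X _]es !blockE. Qed.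

Lemma carroll_mx_ee i j : C (sh i) (sh j) = A i j.
Proof. by rewrite !es !blockE. Qed.

End Entries.

(** This replaces the existential block form by equations that match the geometry: the column
    condition will express that xi is fixed, the row condition that psi is preserved, and the
    orthogonality condition that gamma is preserved. *)
Lemma inhomogeneous_carrollP T :
  inhomogeneous_carroll R d T <->
  [/\ forall i, T i ord0 = (i == ord0)%:R, forall j, T i1 j = (j == i1)%:R &
      forall i j, \sum_k T (sh k) (sh i) * T (sh k) (sh j) = (i == j)%:R].
Proof.
split=> [[a [b [f [A [orthA ->]]]]]|[T0 T1 TA]].
  split=> [i|j|i j]; [exact: carroll_mx_col0|exact: carroll_mx_row1|].
  move/matrixP/(_ i j): orthA; rewrite !mxE => <-.
  by apply: eq_bigr => k _; rewrite !carroll_mx_ee mxE.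
pose A : 'M[R]_d := \matrix_(i, j) T (sh i) (sh j).
pose c : 'rV[R]_d := \row_j T ord0 (sh j).
have orthA : A^T *m A = 1%:M.
  apply/matrixP => i j; rewrite !mxE -TA.
  by apply: eq_bigr => k _; rewrite !mxE.
(* The upper right row [c] is arbitrary: with [f = - (A *m c^T)] one gets
   [- (f^T *m A) = c *m (A^T *m A) = c]. *)
exists (T ord0 i1), (\col_i T (sh i) i1), (- (A *m c^T)), A; split=> //.
apply/matrixP => i j; case: (ord_frameP j) => [->|->|[l ->]].
- by rewrite T0 carroll_mx_col0.
- case: (ord_frameP i) => [->|->|[k ->]].
  + by rewrite carroll_mx_01.
  + by rewrite T1 carroll_mx_row1.
  + by rewrite carroll_mx_e1 mxE.
- case: (ord_frameP i) => [->|->|[k ->]].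
  + rewrite carroll_mx_0e linearN /= trmx_mul trmxK mulNmx -mulmxA orthA mulmx1.
    by rewrite !mxE opprK.
  + by rewrite T1 carroll_mx_row1.
  + by rewrite carroll_mx_ee mxE.
Qed.

End CarrollGroup.

(** * Linear algebra of psi and gamma on one tangent space *)

Section Geometry.
Variables (R : realType) (d : nat) (M : manifold R d.+2).
Variables (L : ambient_leibnizian M) (x : M).

Local Notation V := (tangent x).
Local Notation W := (subvs_of (lker (psi L x))).
Local Notation xi := (xi L x).
Local Notation psi := (psi L x).
Local Notation gamma := (@gamma R d.+2 M L x).
Local Notation i1 := (lift ord0 ord0 : 'I_d.+2).
Local Notation sh i := (lift ord0 (lift ord0 i : 'I_d.+1) : 'I_d.+2).

Definition orthonormal k (e : k.-tuple W) : Prop :=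
  forall i j, gamma (tnth e i) (tnth e j) = (i == j)%:R.

Lemma gammaDl u v w : gamma (u + v) w = gamma u w + gamma v w.
Proof. by have := gamma_linear w 1 u v; rewrite scale1r mul1r. Qed.

Lemma gamma0l w : gamma 0 w = 0.
Proof. by apply: (addrI (gamma 0 w)); rewrite -gammaDl !addr0. Qed.

Lemma gammaZl a u w : gamma (a *: u) w = a * gamma u w.
Proof. by have := gamma_linear w a u 0; rewrite gamma0l !addr0. Qed.

Lemma gamma_suml (I : finType) (c : I -> R) (u : I -> W) w :
  gamma (\sum_i c i *: u i) w = \sum_i c i * gamma (u i) w.
Proof.
elim/big_ind2: _ => [|v a v' a' <- <-|i _]; first exact: gamma0l.
  by rewrite gammaDl.
by rewrite gammaZl.
Qed.

(* The discriminant argument for a positive semi-definite form. *)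
Lemma gamma_isotropic w v : gamma w w = 0 -> gamma w v = 0.
Proof.
move=> ww0; apply: contrapT => /eqP wv0.
set c := gamma w v in wv0; set q := gamma v v.
pose t := - (q + 1) / (2 * c).
(* Since [gamma w w = 0], the left side is [2 * (t * c) + q], and [t] was chosen to make it -1. *)
have := gamma_ge0 (t *: w + v).
rewrite gamma_linear [gamma w _]gamma_sym [gamma v (t *: w + v)]gamma_sym.
rewrite !gamma_linear ww0 (gamma_sym v w) -/c -/q mulr0 add0r.
have tc : 2 * (t * c) = - (q + 1).
  by rewrite mulrCA mulfVK // mulf_neq0 // pnatr_eq0.
by rewrite addrA -mulr2n -mulr_natl tc opprD addrAC addNr add0r ler0N1.
Qed.

Lemma psi_vsval (w : W) : psi (vsval w) = 0.
Proof. by apply/eqP; rewrite -memv_ker subvsP. Qed.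

Lemma xi_in_lker : xi \in lker psi.
Proof. by rewrite memv_ker psi_xi. Qed.

Lemma gamma_xil w : gamma (vsproj _ xi) w = 0.
Proof.
move: w; apply/(gamma_radical (vsproj _ xi)).
by rewrite vsprojK ?xi_in_lker ?memv_line.
Qed.

Lemma dim_tangent : \dim {:V} = d.+2.
Proof. by rewrite dimvf. Qed.

(** Gram-Schmidt modulo the radical. The kernel of psi has dimension at least d + 1, so for k < d it
    is not covered by the span of xi and k vectors. *)
Lemma orthonormal_exists k : (k <= d)%N -> exists e : k.-tuple W, orthonormal e.
Proof.
elim: k => [_|k IHk kd]; first by exists [tuple] => -[].
have [e e_on] := IHk (ltnW kd).
have : ~~ (lker psi <= <<xi :: map vsval e>>)%VS.
  apply/negP => /dimvS le1.
  have le2 := leq_trans le1 (dim_span _); rewrite /= size_map size_tuple in le2.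
  have := limg_ker_dim psi fullv; rewrite capfv dim_tangent => dimE.
  have le3 : (\dim (limg psi) <= 1)%N.
    by have := dimvS (subvf (limg psi)); rewrite dimvf.
  have := leq_add le2 le3; rewrite dimE addn1 !ltnS.
  by move=> /(leq_trans kd); rewrite ltnn.
case/subvPn => u0 u0W u0S.
pose u : W := vsproj _ u0; have uE : vsval u = u0 by rewrite vsprojK.
pose w := u - \sum_i gamma u (tnth e i) *: tnth e i.
have we i : gamma w (tnth e i) = 0.
  rewrite /w -scaleN1r addrC gamma_linear gamma_suml (bigD1 i) //= big1.
    by rewrite e_on eqxx addr0 mulr1 mulN1r addNr.
  by move=> j ji; rewrite e_on (negPf ji) mulr0.
(* If [gamma w w] vanished, [w] would be isotropic, hence in the radical, that is a multiple of xi;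
   then [u0] would lie in the span that it was chosen to avoid. *)
have ww : 0 < gamma w w.
  rewrite lt_neqAle gamma_ge0 andbT eq_sym; apply/negP => /eqP w0.
  have /(gamma_radical w) : forall v, gamma w v = 0.
    by move=> v; exact: gamma_isotropic.
  move=> wxi; move/negP: u0S; apply; rewrite -uE.
  rewrite -(subrK (\sum_i gamma u (tnth e i) *: tnth e i) u) linearD /=.
  apply: memvD.
    by apply: subvP wxi; rewrite -memvE memv_span ?mem_head.
  rewrite linear_sum; apply: memv_suml => i _; rewrite linearZ /= memvZ //.
  by rewrite memv_span // inE map_f ?orbT // mem_tnth.
pose n := Num.sqrt (gamma w w).
have n0 : n != 0 by rewrite sqrtr_eq0 -ltNge.
have ne i : gamma (n^-1 *: w) (tnth e i) = 0 by rewrite gammaZl we mulr0.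
exists [tuple of n^-1 *: w :: e] => i j.
case: (unliftP ord0 i) => [i' ->|->]; case: (unliftP ord0 j) => [j' ->|->];
  rewrite ?tnthS ?tnth0.
- by rewrite e_on (inj_eq lift_inj).
- by rewrite gamma_sym ne.
- by rewrite ne.
have nn : gamma w w = n * n by rewrite -expr2 sqr_sqrtr // ltW.
by rewrite gammaZl gamma_sym gammaZl nn mulKf // mulVf.
Qed.

Lemma psi_eq1_exists : exists N, psi N = 1.
Proof.
have [v v0] : exists v, psi v != 0.
  apply: contrapT => h; have /negP := psi_neq0 L x; apply; apply/eqP/lfunP => v.
  by rewrite zero_lfunE; apply: contrapT => /eqP ?; apply: h; exists v.
by exists ((psi v)^-1 *: v); rewrite linearZ; exact: mulVf.
Qed.

(** * Coordinates in a Leibnizian frame *)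

Definition frame (N : V) (e : d.-tuple W) : d.+2.-tuple V :=
  [tuple of [:: xi, N & map_tuple vsval e]].

Section Frame.
Variables (N : V) (e : d.-tuple W).
Hypotheses (psiN : psi N = 1) (e_on : orthonormal e).

Lemma nth_frame0 : (frame N e)`_(ord0 : 'I_d.+2) = xi.
Proof. by []. Qed.

Lemma nth_frame1 : (frame N e)`_i1 = N.
Proof. by []. Qed.

Lemma nth_frameS (i : 'I_d) : (frame N e)`_(sh i) = vsval (tnth e i).
Proof.
by rewrite (tnth_nth 0) /= (nth_map 0) // size_tuple; exact: ltn_ord i.
Qed.

Lemma sum_frame (c : 'I_d.+2 -> R) :
  \sum_i c i *: (frame N e)`_i =
  c ord0 *: xi + (c i1 *: N + vsval (\sum_i c (sh i) *: tnth e i)).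
Proof.
rewrite big_ord_recl big_ord_recl nth_frame0 nth_frame1 linear_sum.
congr (_ + (_ + _)); apply: eq_bigr => i _.
by rewrite nth_frameS linearZ.
Qed.

Lemma psi_sum_frame (c : 'I_d.+2 -> R) :
  psi (\sum_i c i *: (frame N e)`_i) = c i1.
Proof.
rewrite sum_frame !linearD !linearZ /= psi_xi psi_vsval psiN.
by rewrite scaler0 add0r addr0; exact: mulr1.
Qed.

(** The coefficient of N is killed by psi and that of xi by gamma. The coefficients are arbitrary
    rather than [coord], because the freeness of the frame is itself deduced from this. *)
Lemma gamma_sum_frame (c : 'I_d.+2 -> R) (w : W) j :
  vsval w = \sum_i c i *: (frame N e)`_i -> gamma w (tnth e j) = c (sh j).
Proof.
move=> wE; have c1 : c i1 = 0 by rewrite -psi_sum_frame -wE psi_vsval.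
have -> : w = c ord0 *: vsproj _ xi + \sum_i c (sh i) *: tnth e i.
  apply: val_inj; rewrite /= wE sum_frame c1 scale0r add0r.
  by rewrite vsprojK ?xi_in_lker.
rewrite gamma_linear gamma_xil mulr0 add0r gamma_suml (bigD1 j) //= big1.
  by rewrite e_on eqxx mulr1 addr0.
by move=> i ij; rewrite e_on (negPf ij) mulr0.
Qed.

(** In a vanishing combination, gamma and psi detect every coefficient except that of xi, which
    vanishes since xi is nonzero; counting dimensions does the rest. *)
Lemma frame_basis : basis_of fullv (frame N e).
Proof.
rewrite basisEfree subvf size_tuple dim_tangent leqnn !andbT.
apply/freeP => c c0.
have ce j : c (sh j) = 0.
  by rewrite -(@gamma_sum_frame c 0 j) ?gamma0l // c0 linear0.
have c1 : c i1 = 0 by rewrite -psi_sum_frame c0 linear0.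
move=> i; case: (ord_frameP i) => [->|->|[k ->]] //.
move: c0; rewrite sum_frame c1 scale0r add0r big1 => [|k _].
  rewrite linear0 addr0 => /eqP.
  by rewrite scaler_eq0 (negPf (xi_neq0 L x)) orbF => /eqP.
by rewrite ce scale0r.
Qed.

Let b := frame N e.
Let bB := frame_basis.

Lemma coord_frame_psi v : coord b i1 v = psi v.
Proof. by rewrite [v in RHS](coord_basis bB (memvf v)) psi_sum_frame. Qed.

Lemma coord_frame_gamma w i : coord b (sh i) (vsval w) = gamma w (tnth e i).
Proof.
by apply/esym/(@gamma_sum_frame (fun i => coord b i (vsval w)));
  exact: (coord_basis bB (memvf _)).
Qed.

(** A vector of the kernel differs from its expansion along [e] by a multiple of xi, which gamma
    does not see. *)
Lemma frame_parseval u w :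
  gamma u w = \sum_k gamma u (tnth e k) * gamma w (tnth e k).
Proof.
have wxi : u - \sum_k gamma u (tnth e k) *: tnth e k
    = coord b ord0 (vsval u) *: vsproj _ xi.
  apply: val_inj; rewrite /= vsprojK ?xi_in_lker //.
  rewrite {1}(coord_basis bB (memvf (vsval u))) sum_frame -/b.
  rewrite coord_frame_psi psi_vsval scale0r add0r.
  under [X in _ + vsval X - _ = _]eq_bigr do rewrite coord_frame_gamma.
  by rewrite addrK.
move/eqP: wxi; rewrite subr_eq => /eqP {1}->.
rewrite gamma_linear gamma_xil mulr0 add0r gamma_suml.
by apply: eq_bigr => k _; rewrite [gamma w _]gamma_sym.
Qed.

End Frame.

(** The use of [vsproj] in the last clause is sound because the second clause keeps the images in
    the kernel of psi. *)
Definition preserves_leibnizian (f : 'End(V)) : Prop :=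
  [/\ f xi = xi, forall v, psi (f v) = psi v &
      forall u w : W,
        gamma (vsproj _ (f (vsval u))) (vsproj _ (f (vsval w))) = gamma u w].

Lemma preserves_in_lker f (w : W) :
  preserves_leibnizian f -> f (vsval w) \in lker psi.
Proof. by case=> _ fpsi _; rewrite memv_ker fpsi psi_vsval. Qed.

(** * Structure-preserving maps correspond to Carroll matrices *)

Section Matrix.
Variables (N : V) (e : d.-tuple W).
Hypotheses (psiN : psi N = 1) (e_on : orthonormal e).
Let b := frame N e.
Let bB : basis_of fullv b := frame_basis psiN e_on.

Lemma preserves_carroll f :
  preserves_leibnizian f <-> inhomogeneous_carroll R d (lmx b f).
Proof.
rewrite inhomogeneous_carrollP; split=> [pf|[T0 T1 TA]].
  have [fxi fpsi fgamma] := pf; split.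
  - by move=> i; rewrite mxE nth_frame0 fxi -(nth_frame0 N e) coord_free
      ?(basis_free bB) // eq_sym.
  - move=> j; rewrite mxE coord_frame_psi // fpsi -(coord_frame_psi psiN e_on).
    by rewrite coord_free ?(basis_free bB).
  move=> i j; rewrite -e_on -fgamma (frame_parseval psiN e_on).
  apply: eq_bigr => k _; rewrite !mxE !nth_frameS.
  by rewrite -!(coord_frame_gamma psiN e_on) !vsprojK ?preserves_in_lker.
have fpsi v : psi (f v) = psi v.
  rewrite -!(coord_frame_psi psiN e_on) coord_lmx // (bigD1 i1) //= big1.
    by rewrite T1 eqxx mul1r addr0.
  by move=> j j1; rewrite T1 (negPf j1) mul0r.
have fW (w : W) : f (vsval w) \in lker psi by rewrite memv_ker fpsi psi_vsval.
split=> //.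
  apply: (coord_inj bB) => i; have := T0 i; rewrite mxE nth_frame0 => ->.
  by rewrite -(nth_frame0 N e) coord_free ?(basis_free bB) // eq_sym.
(* The xi-coordinate drops out because the first column of the matrix is zero there, and the
   N-coordinate because it equals [psi w = 0]. *)
have fe (w : W) k : gamma (vsproj _ (f (vsval w))) (tnth e k) =
    \sum_l lmx b f (sh k) (sh l) * gamma w (tnth e l).
  rewrite -(coord_frame_gamma psiN e_on) vsprojK ?fW // coord_lmx //.
  rewrite big_ord_recl T0 mul0r add0r big_ord_recl coord_frame_psi // psi_vsval.
  rewrite mulr0 add0r; apply: eq_bigr => l _.
  by rewrite (coord_frame_gamma psiN e_on).
(* After expansion, the coefficient of [gamma u (tnth e l) * gamma w (tnth e m)] is the scalar
   product of columns l and m of the orthogonal block, so only l = m survives. *)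
move=> u w; rewrite (frame_parseval psiN e_on) [RHS](frame_parseval psiN e_on).
under eq_bigr do rewrite !fe mulr_suml.
rewrite exchange_big; apply: eq_bigr => l _ /=.
under eq_bigr do rewrite mulr_sumr.
rewrite exchange_big (bigD1 l) //= -[RHS]addr0; congr (_ + _).
  under eq_bigr do rewrite mulrACA.
  by rewrite -mulr_suml TA eqxx mul1r.
rewrite big1 // => m ml; under eq_bigr do rewrite mulrACA.
by rewrite -mulr_suml TA eq_sym (negPf ml) mul0r.
Qed.

End Matrix.

(** * Preserving bases amounts to preserving xi, psi and gamma *)

Lemma frame_leibnizian N e :
  psi N = 1 -> orthonormal e -> leibnizian_basis L x (frame N e).
Proof. by move=> psiN e_on; exists N, e; split=> //; exact: frame_basis. Qed.

(** One test frame suffices from left to right: its image is again a frame, which determines the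
    matrix of [f] enough to make it a Carroll matrix. *)
Lemma leibnizian_automorphismsP f :
  leibnizian_automorphisms L x f <-> preserves_leibnizian f.
Proof.
split=> [[_ fL]|pf].
  have [N psiN] := psi_eq1_exists.
  have [e e_on] := orthonormal_exists (leqnn d).
  have [N' [e' [fE _ psiN' e'_on]]] := fL _ (frame_leibnizian psiN e_on).
  have bB := frame_basis psiN e_on.
  have fb (i : 'I_d.+2) : f (frame N e)`_i = (frame N' e')`_i.
    have /(congr1 (fun t => tnth t i)) := fE.
    by rewrite tnth_map !(tnth_nth 0).
  apply/(preserves_carroll psiN e_on)/inhomogeneous_carrollP.
  have fe i : f (vsval (tnth e i)) = vsval (tnth e' i).
    by rewrite -(nth_frameS N) fb nth_frameS.
  split=> [i|j|i j].
  - rewrite mxE fb nth_frame0 -(nth_frame0 N e).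
    by rewrite coord_free ?(basis_free bB) // eq_sym.
  - rewrite mxE fb (coord_frame_psi psiN e_on).
    (* psi is the N-coordinate in every frame, so it may be read in the image frame, where the row
       is evident. *)
    rewrite -(coord_frame_psi psiN' e'_on) coord_free //.
    exact/basis_free/frame_basis.
  rewrite -e'_on (frame_parseval psiN e_on); apply: eq_bigr => k _.
  by rewrite !mxE !nth_frameS !fe !(coord_frame_gamma psiN e_on).
have [fxi fpsi fgamma] := pf; split.
  (* A vector killed by [f] lies in the kernel of psi and then in the radical of gamma, so it is a
     multiple of xi; but [f] fixes xi. *)
  have kf : lker f == 0%VS.
    rewrite -subv0; apply/subvP => v; rewrite memv_ker => /eqP fv0.
    have vW : v \in lker psi by rewrite memv_ker -fpsi fv0 linear0.
    have /(gamma_radical (vsproj _ v)) : forall w, gamma (vsproj _ v) w = 0.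
      by move=> w; rewrite -fgamma vsprojK // fv0 linear0 gamma0l.
    rewrite vsprojK // => /vlineP[c vE]; move: fv0; rewrite vE linearZ /= fxi.
    by move=> ->; rewrite mem0v.
  by exists f^-1%VF; [exact: lker0_lfunK|exact: lker0_lfunVK].
move=> _ [N [e [-> _ psiN e_on]]].
pose e' : d.-tuple W := map_tuple (fun w => vsproj _ (f (vsval w))) e.
have -> : map_tuple f [tuple of [:: xi, N & map_tuple vsval e]] =
          frame (f N) e'.
  apply: val_inj; rewrite /= fxi; congr [:: _, _ & _].
  rewrite -!map_comp; apply: eq_map => w /=.
  by rewrite vsprojK ?preserves_in_lker.
apply: frame_leibnizian; first by rewrite fpsi.
by move=> i j; rewrite !tnth_map fgamma.
Qed.

End Geometry.

Theorem proposition2p20 (R : realType) (d : nat) (M : manifold R d.+2)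
    (L : ambient_leibnizian M) (x : M) :
  [/\ is_group (fun f g => (f \o g)%VF) \1%VF (leibnizian_automorphisms L x),
      inhomogeneous_carroll R d `<=` [set T | T \in unitmx],
      is_group (fun S T => S *m T) 1%:M (inhomogeneous_carroll R d) &
      isomorphic_groups (fun f g => (f \o g)%VF) (leibnizian_automorphisms L x)
        (fun S T => S *m T) (inhomogeneous_carroll R d)].
Proof.
(* The isomorphism is [lmx b], and it depends on the frame chosen here. *)
have [N psiN] := psi_eq1_exists L x.
have [e e_on] := orthonormal_exists L x (leqnn d).
have bB := frame_basis psiN e_on; set b := frame N e in bB.
have lmxP f : leibnizian_automorphisms L x f <->
    inhomogeneous_carroll R d (lmx b f).
  by rewrite leibnizian_automorphismsP; exact: preserves_carroll.
have carroll_group := inhomogeneous_carroll_group R d.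
have [C1 CM _ _ CV] := carroll_group.
have lmxM f g : lmx b (f \o g)%VF = lmx b f *m lmx b g by exact: lmx_comp.
have lmx1 : lmx b \1%VF = 1%:M by exact: lmx_id.
split=> //; last 1 first.
- exists (lmx b); split; last by move=> f g _ _; exact: lmxM.
  split; first by move=> f /lmxP.
    by move=> f g _ _; exact: lmx_inj.
  by move=> T CT; have [f fT] := lmx_surj bB T; exists f; rewrite //= lmxP fT.
- split.
  + by apply/lmxP; rewrite lmx1.
  + by move=> f g /lmxP Cf /lmxP Cg; apply/lmxP; rewrite lmxM; exact: CM.
  + by move=> f g h _ _ _; rewrite comp_lfunA.
  + by move=> f _; rewrite comp_lfun1l comp_lfun1r.
  (* Closure under inverses is not evident from the definition, which only asks that bases go to
     bases; the inverse is lifted from the matrix group. *)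
  + move=> f /lmxP/CV[T [CT fT Tf]]; have [g gT] := lmx_surj bB T.
    by exists g; split; [apply/lmxP; rewrite gT|
      apply: (lmx_inj bB); rewrite lmxM lmx1 gT|
      apply: (lmx_inj bB); rewrite lmxM lmx1 gT].
- exact: inhomogeneous_carroll_unitmx.
Qed.
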